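(* Let $q$ be a complex number with $0<|q|<1$, let $m,n$ be nonnegative integers, and let $x\in\mathbb{C}$ with $x\neq q^l$ for every integer $l$. Then $$\sum_{k=0}^m \frac{(q^{-m};q)_k\,(-1)^k q^{k(k-2n-1)/2}\,x^k}{(q,x/q^m;q)_k}=\frac{(xq^{-n};q)_\infty}{(xq^{-m};q)_\infty}\sum_{k=0}^n \frac{(q^{-n};q)_k\,(-1)^k q^{k(k-2m-1)/2}\,x^k}{(q,x/q^n;q)_k}.$$
   Context: Here $(x;q)_k=\prod_{j=0}^{k-1}(1-xq^j)$, $(x;q)_\infty=\prod_{j\ge0}(1-xq^j)$, and $(x,y;q)_k=(x;q)_k(y;q)_k$. *)

(* Defs.v *)
From HB Require Import structures.
From mathcomp Require Import all_boot all_order all_algebra.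
From mathcomp Require Import all_classical all_reals all_analysis.
From mathcomp Require Import complex.

Set Implicit Arguments.
Unset Strict Implicit.
Unset Printing Implicit Defensive.

Import Order.TTheory GRing.Theory Num.Theory.
Import numFieldNormedType.Exports.

Local Open Scope ring_scope.
Local Open Scope classical_set_scope.

Definition qpoch (K : numFieldType) (x q : K) (k : nat) : K :=
  \prod_(j < k) (1 - x * q ^+ j).

(* The limit is taken in the topology of the norm of [K]; [K] is a parameter
   because [R[i]] has its normed topology only when seen as a [numFieldType]. *)
Definition qpoch_inf (K : numFieldType) (x q : K) : K :=
  lim (qpoch x q k @[k --> \oo]).

Definition half_exponent (k n : nat) : int :=
  ((k%:Z * (k%:Z - 2 * n%:Z - 1))%R %/ 2)%Z.

(* The Euclidean division in [half_exponent] is exact. *)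
Lemma half_exponentE (k n : nat) :
  half_exponent k n * 2 = k%:Z * (k%:Z - 2 * n%:Z - 1).
Proof.
apply: divzK; have -> : k%:Z * (k%:Z - 2 * n%:Z - 1)
    = k%:Z * (k%:Z - 1) - 2 * (n%:Z * k%:Z).
  by rewrite [k%:Z - _ - 1]addrAC mulrBr mulrCA (mulrC n%:Z).
apply: rpredB; last exact: dvdz_mulr.
case: k => [|k]; first by rewrite mul0r dvdz0.
have -> : k.+1%:Z * (k.+1%:Z - 1) = (k.+1 * k)%N%:Z.
  by rewrite -addn1 PoszD addrK PoszM PoszD.
by rewrite dvdzE absz_nat dvdn2 oddM /= andNb.
Qed.

(* Main.v *)
Require Import Defs.
From HB Require Import structures.
From mathcomp Require Import all_boot all_order all_algebra.
From mathcomp Require Import all_classical all_reals all_analysis.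
From mathcomp Require Import complex ring lra.

Set Implicit Arguments.
Unset Strict Implicit.
Unset Printing Implicit Defensive.

Import Order.TTheory GRing.Theory Num.Theory.
Import numFieldNormedType.Exports.

Local Open Scope ring_scope.
Local Open Scope complex_scope.

(* Multiplying the left-hand sum by its common denominator (x q^-m; q)_m gives
   sum_s (q^-m; q)_s (q^-n; q)_s / (q; q)_s x^s, which is symmetric in m and n:
   with q^-n replaced by a free parameter z, both sides satisfy
   F_(m+1)(z) = F_m(z) - q^-(m+1) x (1 - z) F_m(z q).
   The theorem follows since (x q^-m; q)_oo = (x q^-m; q)_m (x; q)_oo, where
   (x; q)_oo converges to a nonzero limit: after dropping finitely many factors,
   all partial products have modulus between 1/2 and 2. *)

(** * Finite q-shifted factorials *)

Lemma qpochS (K : numFieldType) (x q : K) (k : nat) :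
  qpoch x q k.+1 = qpoch x q k * (1 - x * q ^+ k).
Proof. by rewrite /qpoch big_ord_recr. Qed.

Lemma qpochD (K : numFieldType) (x q : K) (m k : nat) :
  qpoch x q (m + k) = qpoch x q m * qpoch (x * q ^+ m) q k.
Proof.
rewrite /qpoch big_split_ord; congr (_ * _); apply: eq_bigr => j _.
by rewrite exprD mulrA.
Qed.

Lemma qpoch0 (K : numFieldType) (x q : K) : qpoch x q 0 = 1.
Proof. exact: big_ord0. Qed.

Lemma qpochSl (K : numFieldType) (x q : K) (k : nat) :
  qpoch x q k.+1 = (1 - x) * qpoch (x * q) q k.
Proof. by rewrite -add1n qpochD qpochS qpoch0 expr0 expr1 mulr1 mul1r. Qed.

Lemma qpoch_neq0 (K : numFieldType) (x q : K) (k : nat) :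
  (forall j, x * q ^+ j != 1) -> qpoch x q k != 0.
Proof.
by move=> xq; apply/prodf_neq0 => j _; rewrite subr_eq0 eq_sym.
Qed.

(** * Terminating sums and their symmetry in m and n *)

Section FiniteTransformation.
Variables (K : numFieldType) (q : K).
Hypotheses (q_neq0 : q != 0) (q_notroot : forall k, q ^+ k.+1 != 1).

Let qq_neq0 k : qpoch q q k != 0.
Proof. by apply: qpoch_neq0 => j; rewrite -exprS. Qed.

Let expq_neq0 k : q ^+ k != 0. Proof. exact: expf_neq0. Qed.

Let exprVB m k : (k <= m)%N -> q ^- (m - k) = q ^- m * q ^+ k.
Proof. by move=> km; rewrite -{2}(subnK km) exprD invfM divfK. Qed.

(** The Gaussian binomial coefficient of [m] and [k] times (-1)^k q^(k(k-1)/2 - mk). *)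
Definition qcoef (m k : nat) : K := qpoch (q ^- m) q k / qpoch q q k.

Lemma qcoef0 m : qcoef m 0 = 1.
Proof. by rewrite /qcoef !qpoch0 divr1. Qed.

(** The factor of index j = m in (q^-m; q)_k is 1 - q^-m q^m = 0. *)
Lemma qcoef_small m k : (m < k)%N -> qcoef m k = 0.
Proof.
move=> mk; rewrite /qcoef -(subnKC mk) qpochD qpochS mulVf //.
by rewrite subrr mulr0 !mul0r.
Qed.

(** A q-Pascal rule: all three numerators contain (q^-m; q)_k. *)
Lemma qcoefSS m k :
  qcoef m.+1 k.+1 = qcoef m k.+1 - q ^- m.+1 * qcoef m k.
Proof.
have q1 : 1 - q * q ^+ k != 0 by rewrite subr_eq0 eq_sym -exprS.
rewrite /qcoef [qpoch (q ^- m.+1) q k.+1]qpochSl.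
have -> : q ^- m.+1 * q = q ^- m by rewrite exprS invfM mulrAC mulVf ?mul1r.
rewrite !qpochS exprS; field.
by rewrite qq_neq0 q1 q_neq0 expq_neq0.
Qed.

(* [phi21 m x z] is 2phi1(q^-m, z; 0; q, x), and [phi11 m x z] is
   1phi1(q^-m; x q^-m; q, z x) times its common denominator
   [qpoch (x * q ^- m) q m]. *)
Definition phi21 (m : nat) (x z : K) : K :=
  \sum_(k < m.+1) qcoef m k * qpoch z q k * x ^+ k.

Definition phi11 (m : nat) (x z : K) : K :=
  \sum_(k < m.+1) qcoef m k * ((-1) ^+ k * q ^+ 'C(k, 2) * (z * x) ^+ k)
    * qpoch (x * q ^- (m - k)) q (m - k).

(** The weights [F] are arbitrary so that the q-Pascal rule serves both [phi21] and [phi11]. *)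
Lemma sum_qcoefS m (F : nat -> K) :
  \sum_(k < m.+2) qcoef m.+1 k * F k
  = \sum_(k < m.+1) qcoef m k * F k
    - q ^- m.+1 * \sum_(k < m.+1) qcoef m k * F k.+1.
Proof.
rewrite big_ord_recl qcoef0 -(qcoef0 m).
under eq_bigr => k _ do rewrite lift0 qcoefSS mulrBl.
rewrite sumrB addrA; under [X in _ - X]eq_bigr do rewrite -mulrA.
rewrite -mulr_sumr; congr (_ - _).
(* The added term of index m + 1 is zero. *)
have -> : \sum_(k < m.+1) qcoef m k * F k = \sum_(k < m.+2) qcoef m k * F k.
  by rewrite [RHS]big_ord_recr /= qcoef_small // mul0r addr0.
by rewrite [RHS]big_ord_recl.
Qed.

Lemma phi21S m x z :
  phi21 m.+1 x z = phi21 m x z - q ^- m.+1 * x * (1 - z) * phi21 m x (z * q).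
Proof.
rewrite /phi21; under eq_bigr do rewrite -mulrA.
rewrite (sum_qcoefS m (fun k => qpoch z q k * x ^+ k)).
under eq_bigr do rewrite mulrA.
rewrite -!mulrA; congr (_ - _ * _); rewrite !mulr_sumr.
by apply: eq_bigr => k _; rewrite qpochSl exprS; ring.
Qed.

(** Holds term by term: the summands of index k share a factor, and what is left on either side is 1
    - q^(k-m-1) x (1 - z). *)
Lemma phi11S m x z :
  phi11 m.+1 x z = phi11 m x z - q ^- m.+1 * x * (1 - z) * phi11 m x (z * q).
Proof.
rewrite /phi11; under eq_bigr do rewrite -mulrA.
rewrite (sum_qcoefS m (fun k => ((-1) ^+ k * q ^+ 'C(k, 2) * (z * x) ^+ k)
    * qpoch (x * q ^- (m.+1 - k)) q (m.+1 - k))).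
rewrite !mulr_sumr -!sumrB; apply: eq_bigr => -[k /=]; rewrite ltnS => km _.
rewrite subSS binS bin1 exprD subSn // qpochSl.
have -> : x * q ^- (m - k).+1 * q = x * q ^- (m - k).
  by rewrite exprSr invfM -!mulrA mulVf // mulr1.
have -> : q ^- (m - k).+1 = q ^- m.+1 * q ^+ k.
  by rewrite -subSn // exprVB // leqW.
by rewrite !exprMn !exprS; ring.
Qed.

(** The recurrence replaces z by z q, so the induction on m keeps z general. *)
Lemma phi11E m x z : phi11 m x z = phi21 m x z.
Proof.
elim: m z => [|m IH] z; last by rewrite phi11S phi21S !IH.
by rewrite /phi11 /phi21 !big_ord1 /= !qpoch0 !expr0 !mulr1.
Qed.

Lemma phi21_widen m d x z :
  phi21 m x z = \sum_(k < m.+1 + d) qcoef m k * qpoch z q k * x ^+ k.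
Proof.
elim: d => [|d IH]; first by rewrite addn0.
by rewrite addnS big_ord_recr /= -IH qcoef_small ?leq_addr // !mul0r addr0.
Qed.

(** Once both sums are extended by zero terms to k <= m + n, their summands agree. *)
Lemma phi21_sym m n x : phi21 m x (q ^- n) = phi21 n x (q ^- m).
Proof.
rewrite (phi21_widen m n) (phi21_widen n m) addSnnS addnC.
by apply: eq_bigr => k _; rewrite /qcoef; congr (_ * _); ring.
Qed.

Lemma exp_half_exponent k n :
  q ^ half_exponent k n = q ^+ 'C(k, 2) * q ^- (n * k).
Proof.
have -> : half_exponent k n = 'C(k, 2)%:Z - (n * k)%N%:Z.
  (* Doubling removes the integer division. *)
  apply: (@mulIf _ (2 : int)) => //; rewrite half_exponentE mulrBl.
  have -> : 'C(k, 2)%:Z * 2 = k%:Z * (k%:Z - 1).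
    case: k => [|k]; first by rewrite mul0r.
    rewrite -PoszM mulnC -mul_bin_diag bin1 PoszM; congr *%R.
    by rewrite /= -addn1 PoszD addrK.
  by rewrite PoszM; ring.
by rewrite expfzDr // -exprnN.
Qed.

(** For k <= m, dividing (x q^-m; q)_m by (x q^-m; q)_k leaves the factor (x q^-(m-k); q)_(m-k) of
    [phi11]. *)
Lemma sum_half_exponentE m n x : (forall l : int, x != q ^ l) ->
  qpoch (x * q ^- m) q m *
  \sum_(k < m.+1)
     (qpoch (q ^- m) q k * (-1) ^+ k * q ^ half_exponent k n * x ^+ k)
       / (qpoch q q k * qpoch (x / q ^+ m) q k)
  = phi21 m x (q ^- n).
Proof.
move=> hx; rewrite -phi11E mulr_sumr; apply: eq_bigr => -[k /=].
rewrite ltnS => km _.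
(* A zero factor would force x = q^(m-j). *)
have xm_neq0 : qpoch (x * q ^- m) q k != 0.
  apply: qpoch_neq0 => j; apply: contra (hx (m%:Z - j%:Z)) => /eqP xj.
  rewrite expfzDr // -exprnN -exprnP -(mulr1 (q ^+ m)) -xj; apply/eqP.
  by field; rewrite !expq_neq0.
have -> : qpoch (x * q ^- m) q m
    = qpoch (x * q ^- m) q k * qpoch (x * q ^- (m - k)) q (m - k).
  rewrite -{2}(subnKC km) qpochD; congr (_ * qpoch _ _ _).
  by rewrite exprVB // mulrA.
rewrite exp_half_exponent exprMn exprVn -exprM /qcoef.
by field; rewrite qq_neq0 xm_neq0 expq_neq0.
Qed.
End FiniteTransformation.

(** * Convergence criteria for real and complex sequences *)

Section Convergence.
Local Open Scope classical_set_scope.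

Lemma cvgn_summable_increments (R : realType) (u v : R ^nat) :
  (forall k, `|u k.+1 - u k| <= v k) -> cvgn (series v) -> cvgn u.
Proof.
move=> uv cv; have : cvgn (series (telescope u)).
  apply: normed_cvg; apply: series_le_cvg cv => k; first exact: normr_ge0.
    exact: le_trans (uv k).
  exact: uv.
move=> cu; have -> : u = series (telescope u) \+ cst (u 0%N).
  by apply/funext => k; rewrite /= telescopeK /= subrK.
exact: is_cvgD cu (is_cvg_cst _).
Qed.

Lemma normcR (R : rcfType) (a : R) : `|a%:C| = `|a|%:C.
Proof. by rewrite normc_def /= expr0n addr0 sqrtr_sqr. Qed.

Lemma normci (R : rcfType) : `|'i%C| = 1 :> R[i].
Proof. by rewrite normc_def /= expr0n expr1n add0r sqrtr1. Qed.

Lemma cvgn_complex (R : realType) (u : nat -> R[i]) :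
  cvgn (fun k => complex.Re (u k)) -> cvgn (fun k => complex.Im (u k)) ->
  cvgn (u : nat -> (R[i] : numFieldType)).
Proof.
set a := lim _; set b := lim _.
move=> ca cb; apply/cvg_ex; exists (a +i* b).
apply/cvgrPdist_lt => e e0.
(* A positive element of [R[i]] is real, so [e] can be split evenly between the two components. *)
have eE : e = (complex.Re e)%:C by rewrite RRe_real // gtr0_real.
have e2 : 0 < complex.Re e / 2 by rewrite divr_gt0 // -ltcR -eE.
near=> k.
have : `|a - complex.Re (u k)| < complex.Re e / 2.
  by near: k; move/cvgrPdist_lt : ca; apply.
have : `|b - complex.Im (u k)| < complex.Re e / 2.
  by near: k; move/cvgrPdist_lt : cb; apply.
move=> hb ha; rewrite eE -[X in `|X|]/((a +i* b) - u k) [_ - _]complexE.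
apply: le_lt_trans (ler_normD _ _) _; rewrite normrM.
rewrite normci mul1r !normcR -raddfD ltcR !raddfB /=; lra.
Unshelve. all: by end_near. Qed.

Lemma cvgn_complex_summable_increments (R : realType) (u : nat -> R[i])
    (v : R ^nat) :
  (forall k, `|u k.+1 - u k| <= (v k)%:C) -> cvgn (series v) ->
  cvgn (u : nat -> (R[i] : numFieldType)).
Proof.
move=> uv cv; apply: cvgn_complex; apply: cvgn_summable_increments cv => k.
  rewrite -lecR; apply: le_trans (uv k); rewrite -raddfB; exact: normc_ge_Re.
rewrite -lecR; apply: le_trans (uv k); rewrite -raddfB.
(* Up to sign, an imaginary part is the real part of the product with ['i]. *)
rewrite -normrN -ReiNIm; apply: le_trans (normc_ge_Re _) _.
by rewrite normrM normci mulr1.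
Qed.

(* Weierstrass bounds: under [x_small] the moduli of the [x * q ^+ j], j < k,
   sum to at most [partial k] <= 1/2. *)
Section SmallArgument.
Variables (K : numFieldType) (x q : K).
Hypotheses (q_lt1 : `|q| < 1) (x_small : `|x| <= (1 - `|q|) / 2).

Let partial (k : nat) : K := (1 - `|q| ^+ k) / 2.
Let term (k : nat) : K := (1 - `|q|) / 2 * `|q| ^+ k.

Let partialS k : partial k.+1 = partial k + term k.
Proof. by rewrite /partial /term exprS; field. Qed.

Let term_ge0 k : 0 <= term k.
Proof. by rewrite mulr_ge0 ?exprn_ge0 // divr_ge0 // subr_ge0 ltW. Qed.

Let partial_ge0 k : 0 <= partial k.
Proof. by rewrite divr_ge0 // subr_ge0 exprn_ile1 // ltW. Qed.

Let partial_le k : partial k <= 2^-1.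
Proof. by rewrite ler_pdivrMr // mulVf // gerBl exprn_ge0. Qed.

Let half_le1 : 2^-1 <= 1 :> K.
Proof. by rewrite invf_le1 // ler1n. Qed.

Let half_le k : 2^-1 <= 1 - partial k.
Proof. have -> : 2^-1 = 1 - 2^-1 :> K by field. exact: lerB. Qed.

Let norm_term k : `|x * q ^+ k| <= term k.
Proof. by rewrite normrM normrX ler_wpM2r // exprn_ge0. Qed.

(** The induction proves the sharper bound [1 - partial k], using (1 - s)(1 - t) >= 1 - (s + t) for
    s, t >= 0. *)
Lemma norm_qpoch_ge k : 2^-1 <= `|qpoch x q k|.
Proof.
apply: le_trans (half_le k) _.
elim: k => [|k IH].
  by rewrite /partial qpoch0 expr0 subrr mul0r subr0 normr1.
rewrite qpochS normrM partialS.
apply: le_trans (_ : (1 - partial k) * (1 - term k) <= _).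
  have -> : (1 - partial k) * (1 - term k)
      = 1 - (partial k + term k) + partial k * term k by ring.
  by rewrite lerDl mulr_ge0.
apply: le_trans (_ : `|qpoch x q k| * (1 - term k) <= _).
  apply: ler_wpM2r => //; rewrite subr_ge0.
  apply: le_trans half_le1; rewrite (le_trans _ (partial_le k.+1)) //.
  by rewrite partialS lerDr.
apply: ler_wpM2l => //; apply: le_trans (lerB_dist _ _).
by rewrite normr1 lerB.
Qed.

Lemma norm_qpoch_le k : `|qpoch x q k| <= 2.
Proof.
(* This is inductive because (1 + t)(1 - (s + t)) <= 1 - s for s, t >= 0. *)
have le1 : `|qpoch x q k| * (1 - partial k) <= 1.
  elim: k => [|k IH].
    by rewrite /partial qpoch0 expr0 subrr mul0r subr0 normr1 mulr1.
  apply: le_trans IH; rewrite qpochS normrM partialS -mulrA ler_wpM2l //.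
  apply: le_trans (_ : (1 + term k) * (1 - (partial k + term k)) <= _).
    apply: ler_wpM2r; last first.
      by apply: le_trans (ler_normB _ _) _; rewrite normr1 lerD.
    by rewrite -partialS subr_ge0 (le_trans (partial_le _)).
  have -> : (1 + term k) * (1 - (partial k + term k))
      = 1 - partial k - term k * (partial k + term k) by ring.
  by rewrite gerBl mulr_ge0 // addr_ge0.
rewrite -(@ler_pM2r _ 2^-1) // divff //; apply: le_trans le1.
by rewrite ler_wpM2l.
Qed.
End SmallArgument.

(** * Convergence and non-vanishing of the infinite product *)

Lemma cvgn_qpoch_small (R : realType) (x q : R[i]) :
  `|q| < 1 -> `|x| <= (1 - `|q|) / 2 ->
  cvgn (qpoch x q : nat -> (R[i] : numFieldType)).
Proof.
move=> q1 hx; pose r := complex.Re `|q|.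
have rE : r%:C = `|q| by rewrite RRe_real // normr_real.
have r0 : 0 <= r by rewrite -ler0c rE.
have r1 : r < 1 by rewrite -ltcR rE rmorph1.
(* The k-th increment has modulus at most 2 |x| |q|^k <= (1 - r) r^k. *)
apply: (@cvgn_complex_summable_increments _ _ (geometric (1 - r) r)); last first.
  by apply: is_cvg_geometric_series; rewrite ger0_norm.
move=> k /=; rewrite qpochS mulrBr mulr1 addrAC subrr add0r normrN normrM.
rewrite normrM normrX !rmorphM rmorphXn rmorphB rmorph1 /= rE mulrA.
rewrite ler_wpM2r ?exprn_ge0 //.
have -> : 1 - `|q| = 2 * ((1 - `|q|) / 2) by field.
by apply: ler_pM => //; apply: norm_qpoch_le.
Qed.

(** Partial products of modulus at least 1/2 cannot tend to 0. *)
Lemma qpoch_inf_small_neq0 (R : realType) (x q : R[i]) :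
  `|q| < 1 -> `|x| <= (1 - `|q|) / 2 -> qpoch_inf x q != 0.
Proof.
move=> q1 hx; apply/eqP => l0.
have : qpoch x q @ \oo --> qpoch_inf x q := cvgn_qpoch_small q1 hx.
move=> /cvgrPdist_lt /(_ 2^-1).
rewrite invr_gt0 ltr0n => /(_ isT) [N _ /(_ N (leqnn N))] /=.
rewrite l0 sub0r normrN.
by move/(le_lt_trans (norm_qpoch_ge q1 hx N)); rewrite ltxx.
Qed.

Lemma qpoch_cvg_shift (K : numFieldType) (x q l : K) (N : nat) :
  qpoch (x * q ^+ N) q @ \oo --> l -> qpoch x q @ \oo --> qpoch x q N * l.
Proof.
move=> cv; rewrite -(cvg_shiftn N).
have -> : [sequence qpoch x q (n + N)]_n
    = cst (qpoch x q N) \* qpoch (x * q ^+ N) q.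
  by apply/funext => k; rewrite /= addnC qpochD.
exact: cvgM (cvg_cst _) cv.
Qed.

Lemma qpoch_inf_shift (K : numFieldType) (x q : K) (N : nat) :
  cvgn (qpoch (x * q ^+ N) q) ->
  qpoch_inf x q = qpoch x q N * qpoch_inf (x * q ^+ N) q.
Proof.
by move=> cv; apply: cvg_lim; [exact: norm_hausdorff | exact: qpoch_cvg_shift].
Qed.

Lemma exists_small_shift (R : realType) (x q : R[i]) :
  `|q| < 1 -> exists N, `|x * q ^+ N| <= (1 - `|q|) / 2.
Proof.
move=> q1; pose r := complex.Re `|q|; pose c := complex.Re `|x|.
have rE : r%:C = `|q| by rewrite RRe_real // normr_real.
have cE : c%:C = `|x| by rewrite RRe_real // normr_real.
have r0 : 0 <= r by rewrite -ler0c rE.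
have r1 : r < 1 by rewrite -ltcR rE rmorph1.
(* The real sequence c r^N tends to 0, hence falls below (1 - r) / 2. *)
have /(cvg_geometric c)/cvgrPdist_lt : `|r| < 1 by rewrite ger0_norm.
move=> /(_ ((1 - r) / 2)); rewrite divr_gt0 ?subr_gt0 // => /(_ isT).
move=> [N _ /(_ N (leqnn N))] /=; rewrite sub0r normrN => small.
exists N; rewrite normrM normrX -rE -cE.
apply: le_trans (_ : ((1 - r) / 2)%:C <= _).
  by rewrite -rmorphXn -rmorphM lecR (le_trans (ler_norm _) (ltW small)).
by rewrite rmorphM rmorphB rmorph1 fmorphV rmorph_nat.
Qed.

(** The first N factors are nonzero by assumption, and the remaining product has a small
    argument. *)
Lemma qpoch_inf_neq0 (R : realType) (x q : R[i]) :
  `|q| < 1 -> (forall j, x * q ^+ j != 1) -> qpoch_inf x q != 0.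
Proof.
move=> q1 xq; have [N hN] := exists_small_shift x q1.
rewrite (qpoch_inf_shift (cvgn_qpoch_small q1 hN)).
by rewrite mulf_neq0 ?qpoch_neq0 // qpoch_inf_small_neq0.
Qed.

Lemma cvgn_qpoch (R : realType) (x q : R[i]) :
  `|q| < 1 -> cvgn (qpoch x q : nat -> (R[i] : numFieldType)).
Proof.
move=> q1; have [N hN] := exists_small_shift x q1.
apply/cvg_ex; exists (qpoch x q N * qpoch_inf (x * q ^+ N) q).
exact/qpoch_cvg_shift/cvgn_qpoch_small.
Qed.
End Convergence.

(** * From the finite symmetry to the ratio of infinite products *)

Theorem theorem3p4 (R : realType) (q : R[i]) (m n : nat) (x : R[i])
    (hq : 0 < `|q| < 1) (hx : forall l : int, x != q ^ l) :
  \sum_(k < m.+1)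
     (qpoch (q ^- m) q k * (-1) ^+ k * q ^ half_exponent k n * x ^+ k)
       / (qpoch q q k * qpoch (x / q ^+ m) q k)
  = qpoch_inf (x * q ^- n) q / qpoch_inf (x * q ^- m) q
    * \sum_(k < n.+1)
        (qpoch (q ^- n) q k * (-1) ^+ k * q ^ half_exponent k m * x ^+ k)
          / (qpoch q q k * qpoch (x / q ^+ n) q k).
Proof.
case/andP: hq => q_gt0 q_lt1; have q0 : q != 0 by rewrite -normr_gt0.
have q_notroot k : q ^+ k.+1 != 1.
  apply/eqP => /(congr1 Num.norm); rewrite normr1 normrX => /eqP.
  by rewrite lt_eqF ?exprn_ilt1.
have xq_neq0 r : qpoch_inf (x * q ^- r) q != 0.
  apply: qpoch_inf_neq0 => // j; apply/negP => /eqP E.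
  have /eqP := hx (r%:Z - j%:Z); apply.
  rewrite expfzDr // -exprnN -exprnP -(mulr1 (q ^+ r)) -E.
  by field; rewrite !expf_neq0.
have infE r : qpoch_inf (x * q ^- r) q = qpoch (x * q ^- r) q r * qpoch_inf x q.
  have xr : x * q ^- r * q ^+ r = x by rewrite divfK ?expf_neq0.
  by rewrite (@qpoch_inf_shift _ _ _ r) xr //; exact: cvgn_qpoch.
have mE := xq_neq0 m; have nE := xq_neq0 n.
rewrite !infE !mulf_eq0 !negb_or in mE nE *.
have /andP[m0 x0] := mE; have /andP[n0 _] := nE.
(* Multiplied by (x q^-m; q)_m, the left side is [phi21 m x (q ^- n)]; symmetry turns it into the
   right-hand sum times (x q^-n; q)_n, and (x; q)_oo cancels in the ratio. *)
apply: (mulfI m0); rewrite sum_half_exponentE // phi21_sym //.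
rewrite -(@sum_half_exponentE _ _ q0 q_notroot n m x hx).
by field; rewrite m0 x0.
Qed.
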